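(* Let $\rho=\{\rho^{(X,\tau)}\}$ be a family assigning to each Polish space $(X,\tau)$ a map $\rho^{(X,\tau)}$ (written simply $\rho$) from the bounded Baire class $1$ functions $X\to\mathbb{R}$ to $\omega_1$. Suppose that for every Polish space $X$, every $A\in\boldsymbol\Delta^0_2(X)$ and all bounded Baire class $1$ functions $f,f_n$ on $X$: (1) $\rho(\chi_A)\approx\alpha_1(A,X\setminus A)$; (2) $\rho$ is essentially linear, i.e. $\rho(cf)\approx\rho(f)$ for $c\ne0$ and $\rho(f+g)\lesssim\max\{\rho(f),\rho(g)\}$; (3) if $f_n\to f$ uniformly then $\rho(f)\lesssim\sup_n\rho(f_n)$; (4) if $h:\mathbb{R}\to\mathbb{R}$ is Lipschitz then $\rho(h\circ f)\lesssim\rho(f)$; (5) if $Y\subseteq X$ is Polish in the subspace topology (equivalently $Y\in\boldsymbol\Pi^0_2(X)$) then $\rho(f|_Y)\lesssim\rho(f)$. Then $\rho(f)\approx\alpha(f)$ for every bounded Baire class $1$ function $f$ on every Polish space.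
   Context: $\theta\lesssim\theta'$ means: for every $1\le\eta<\omega_1$, $\theta'\le\omega^\eta$ implies $\theta\le\omega^\eta$; $\approx$ means both directions. A decreasing sequence $(F_\eta)_{\eta<\lambda}$ of subsets of $X$ is continuous if $F_0=X$, $F_\eta=\bigcap_{\theta<\eta}F_\theta$ for limit $\eta<\lambda$, and $\bigcap_{\eta<\lambda}F_\eta=\emptyset$ if $\lambda$ is a limit; $F_\eta=\emptyset$ for $\eta\ge\lambda$; its transfinite difference is $\bigcup_{\eta<\lambda,\ \eta\text{ even}}(F_\eta\setminus F_{\eta+1})$. For $A,B\subseteq X$, $\alpha_1(A,B)$ is the least $\lambda$ such that some continuous decreasing sequence $(F_\eta)_{\eta<\lambda}$ of closed sets has transfinite difference $H$ with $A\subseteq H\subseteq X\setminus B$ ($\omega_1$ if none). The separation rank $\alpha$: for $A,B\subseteq X$, $D_{A,B}(F)=\overline{F\cap A}\cap\overline{F\cap B}$ for closed $F$; $D^0(F)=F$, $D^{\eta+1}(F)=D(D^\eta(F))$, $D^\eta(F)=\bigcap_{\theta<\eta}D^\theta(F)$ for limit $\eta$; $\alpha(A,B)$ is the least $\eta$ with $D_{A,B}^\eta(X)=\emptyset$; and $\alpha(f)=\sup\{\alpha(\{f\le p\},\{f\ge q\}):p<q\text{ rational}\}$. *)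

(* Defs.v *)
From HB Require Import structures.
From mathcomp Require Import all_boot all_order all_algebra.
From mathcomp Require Import all_classical all_reals all_analysis.
From mathcomp Require Import borel_hierarchy.
From mathcomp Require wochoice.

Set Implicit Arguments.
Unset Strict Implicit.
Unset Printing Implicit Defensive.

Import Order.TTheory GRing.Theory Num.Theory.
Import numFieldNormedType.Exports.

Local Open Scope classical_set_scope.
Local Open Scope ring_scope.

(* The points of a well-ordered uncountable type that have only countably many
   predecessors form a well-order of type omega_1; [omega1] is thus the set of
   countable ordinals, an ordinal being identified with its position. *)
Definition wo_le : rel (set nat) :=
  proj1_sig (wochoice.well_ordering_principle (set nat)).

Definition omega1 : Type :=
  set_type [set x : set nat | countable [set y | wo_le y x]].

HB.instance Definition _ := Choice.copy omega1
  (set_type [set x : set nat | countable [set y | wo_le y x]]).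

Lemma wo_le_wo : wochoice.well_order wo_le.
Proof. exact: proj2_sig (wochoice.well_ordering_principle (set nat)). Qed.

Lemma wo_le_min (S : set (set nat)) : S !=set0 ->
  exists2 x, S x & forall y, S y -> wo_le x y.
Proof.
case=> x0 Sx0.
have [|x [[xS lex] _]] := wo_le_wo (A := mem S).
  by exists x0; rewrite inE.
by exists x => [|y Sy]; [rewrite inE in xS | apply: lex; rewrite inE].
Qed.

Lemma wo_le_total : total wo_le.
Proof.
move=> x y; have [|z] := @wo_le_min [set x; y]; first by exists x; left.
by move=> -[]-> lez; rewrite lez ?orbT//; [right|left].
Qed.

Lemma wo_le_refl : reflexive wo_le.
Proof. by move=> x; have := wo_le_total x x; rewrite orbb. Qed.

Lemma wo_le_anti : antisymmetric wo_le.
Proof.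
move=> x y /andP[xy yx].
have [|z [_ uniqz]] := wo_le_wo (A := mem [set x; y]).
  by exists x; rewrite inE; left.
transitivity z; [symmetry|]; apply: uniqz; split.
- by rewrite inE; left.
- by move=> t; rewrite inE => -[]->//; apply: wo_le_refl.
- by rewrite inE; right.
- by move=> t; rewrite inE => -[]->//; apply: wo_le_refl.
Qed.

Lemma wo_le_trans : transitive wo_le.
Proof.
move=> y x z xy yz.
have [|m] := @wo_le_min [set x; y; z]; first by exists x; left; left.
case=> [[]|] -> lem; first by apply: lem; right.
  suff -> : x = y by [].
  by apply: wo_le_anti; rewrite xy lem//; left; left.
suff <- : y = z by [].
by apply: wo_le_anti; rewrite yz lem//; left; right.
Qed.

Definition o1_le (a b : omega1) := wo_le (set_val a) (set_val b).

Fact o1_le_refl : reflexive o1_le.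
Proof. by move=> a; apply: wo_le_refl. Qed.

Fact o1_le_anti : antisymmetric o1_le.
Proof. by move=> a b /wo_le_anti; apply: val_inj. Qed.

Fact o1_le_trans : transitive o1_le.
Proof. by move=> a b c; apply: wo_le_trans. Qed.

Fact o1_le_total : total o1_le.
Proof. by move=> a b; apply: wo_le_total. Qed.

Fact omega1_display : Order.disp_t. Proof. exact: Order.Disp tt tt. Qed.

HB.instance Definition _ := @Order.Le_isPOrder.Build omega1_display omega1
  o1_le o1_le_refl o1_le_anti o1_le_trans.
HB.instance Definition _ :=
  @Order.POrder_isTotal.Build omega1_display omega1 o1_le_total.

Lemma o1_min (S : set omega1) : S !=set0 ->
  exists2 a, S a & forall b, S b -> (a <= b)%O.
Proof.
case=> a0 Sa0; have [|x [a Sa <-] lea] := @wo_le_min (set_val @` S).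
  by exists (set_val a0), a0.
by exists a => // b Sb; apply: lea; exists b.
Qed.

Lemma o1_wf : well_founded (fun a b : omega1 => (a < b)%O).
Proof.
move=> a; apply: contrapT => na.
have [|b nb minb] := @o1_min [set c | ~ Acc (fun a b => (a < b)%O) c].
  by exists a.
apply: nb; constructor => c cb; apply: contrapT => /minb.
by rewrite leNgt cb.
Qed.

Lemma o1_inhabited : exists a : omega1, True.
Proof.
have [|x _ lex] := @wo_le_min setT; first by exists set0.
suff xP : x \in [set x : set nat | countable [set y | wo_le y x]].
  by exists (SigSub xP).
rewrite inE/=; apply: (@sub_countable _ _ _ [set x]).
  by apply: subset_card_le => y /= yx; apply: wo_le_anti; rewrite yx lex.
exact: finite_set_countable.
Qed.

(* These two facts, with [o1_wf], characterize omega_1 up to isomorphism. *)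
Lemma o1_countable_seg (a : omega1) : countable [set b | (b < a)%O].
Proof.
apply/countable_injP.
have /countable_injP[g gI] :
    countable [set y | wo_le y (set_val a)] by have := valP a; rewrite inE.
exists (g \o set_val) => b c /[!inE]/= ba ca /gI bc.
by apply: val_inj; apply: bc; rewrite inE/=; [apply: (ltW ba)|apply: (ltW ca)].
Qed.

Lemma countable_setU (T : Type) (A B : set T) :
  countable A -> countable B -> countable (A `|` B).
Proof.
move=> cA cB; rewrite -bigcup2E; apply: bigcup_countable => // i _.
by case: i => [|[|i]] //=.
Qed.

Lemma o1_uncountable : ~ countable [set: omega1].
Proof.
move=> ctb.
pose W := [set x : set nat | countable [set y | wo_le y x]].
have cW : countable W.
  apply: (@sub_countable _ _ _ (set_val @` [set: omega1])).
    apply: subset_card_le => x Wx; have xW : x \in W by rewrite inE.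
    by exists (SigSub xW).
  exact: (sub_countable (card_image_le _ _)).
have [allW|] := pselect (forall x, W x).
  have : countable [set: set nat] by apply: sub_countable cW; apply: subset_card_le.
  move=> /countable_injP[g gI].
  pose D := [set n | exists2 A : set nat, g A = n & ~ A n].
  have [DgD|nDgD] := pselect (D (g D)); last by apply: (nDgD); exists D.
  case: (DgD) => A gA nAgD; have AD : A = D by apply: gI; rewrite ?inE.
  by apply: nAgD; rewrite AD.
move=> /existsNP[x0 nWx0].
have [|m nWm minm] := @wo_le_min (~` W); first by exists x0.
apply: nWm; apply: (@sub_countable _ _ _ (W `|` [set m])).
  apply: subset_card_le => y ym; have [Wy|/minm my] := pselect (W y); first by left.
  by right; apply: wo_le_anti; rewrite ym.
by apply: countable_setU => //; apply: countable1.
Qed.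

Definition o1zero : omega1 :=
  xget (projT1 (cid o1_inhabited)) [set a | forall b, (a <= b)%O].

(* Meaningful for nonempty [S]; hence [o1sup] is the supremum of bounded, that
   is countable, sets. *)
Definition o1least (S : set omega1) : omega1 :=
  xget o1zero [set a | S a /\ forall b, S b -> (a <= b)%O].

Definition o1sup (S : set omega1) : omega1 :=
  o1least [set b | forall a, S a -> (a <= b)%O].

Definition o1succ (a : omega1) : omega1 := o1least [set b | (a < b)%O].

Definition o1limit (a : omega1) : Prop :=
  a <> o1zero /\ forall b, a <> o1succ b.

(* Transfinite recursion, see [o1rec0], [o1recS] and [o1recL] below: [l] is
   applied to the set of the values taken before a limit stage. *)
Definition o1rec (T : Type) (z : T) (s : T -> T) (l : set T -> T) :
    omega1 -> T :=
  Fix o1_wf (fun=> T) (fun a prev =>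
    let g (b : omega1) := if pselect (b < a)%O is left h then prev b h else z in
    if pselect (a = o1zero) then z
    else if pselect (exists b, a = o1succ b) is left h
    then s (g (projT1 (cid h)))
    else l [set g b | b in [set b | (b < a)%O]]).


Lemma o1leastP (S : set omega1) : S !=set0 ->
  S (o1least S) /\ forall b, S b -> (o1least S <= b)%O.
Proof.
by move=> /o1_min[a Sa lea]; rewrite /o1least; case: xgetP => [b _ //|/(_ a)[]].
Qed.

Lemma o1zero_le a : (o1zero <= a)%O.
Proof.
have [|b _ leb] := @o1_min setT; first by exists o1zero.
rewrite /o1zero; case: xgetP => [c _ lec|/(_ b)[] c]; first exact: lec.
exact: leb.
Qed.

Lemma o1succ_ubound (a : omega1) : exists b : omega1, (a < b)%O.
Proof.
apply: contrapT => /forallNP nlt; apply: o1_uncountable.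
apply: (@sub_countable _ _ _ ([set b | (b < a)%O] `|` [set a])).
  apply: subset_card_le => b _ /=; case: (ltgtP b a) => [ba|ab|->]; last by right.
    by left.
  by case: (nlt b).
by apply: countable_setU; [exact: o1_countable_seg | exact: countable1].
Qed.

Lemma lt_o1succ a : (a < o1succ a)%O.
Proof. exact: (o1leastP (o1succ_ubound a)).1. Qed.

Lemma o1succ_le (a b : omega1) : (a < b)%O -> (o1succ a <= b)%O.
Proof. exact: (o1leastP (o1succ_ubound a)).2. Qed.

Lemma o1succ_inj : injective o1succ.
Proof.
move=> a b ab; apply: contrapT => /eqP; rewrite neq_lt => /orP[] /o1succ_le.
  by rewrite ab leNgt lt_o1succ.
by rewrite -ab leNgt lt_o1succ.
Qed.

Lemma o1rec_unfold (T : Type) (z : T) s l (a : omega1) : o1rec z s l a =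
  let g (b : omega1) := if pselect (b < a)%O is left _ then o1rec z s l b else z in
  if pselect (a = o1zero) then z
  else if pselect (exists b, a = o1succ b) is left h
  then s (g (projT1 (cid h)))
  else l [set g b | b in [set b | (b < a)%O]].
Proof.
rewrite {1}/o1rec Fix_eq// => c p q pq; suff -> : p = q by [].
by apply: functional_extensionality_dep => b; apply/funext => h; apply: pq.
Qed.

Lemma o1rec0 (T : Type) (z : T) s l : o1rec z s l o1zero = z.
Proof. by rewrite o1rec_unfold /=; case: (pselect (_ = o1zero)). Qed.

Lemma o1recS (T : Type) (z : T) s l (a : omega1) :
  o1rec z s l (o1succ a) = s (o1rec z s l a).
Proof.
rewrite o1rec_unfold /=; case: (pselect (_ = o1zero)) => [a0|_] /=.
  by have := lt_o1succ a; rewrite a0 ltNge o1zero_le.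
case: (pselect (exists _, _)) => [h|[]]; last by exists a.
case: (cid h) => b ab /=; rewrite -(o1succ_inj ab).
by case: pselect => // -[]; apply: lt_o1succ.
Qed.

Lemma o1recL (T : Type) (z : T) s l (a : omega1) : o1limit a ->
  o1rec z s l a = l [set o1rec z s l b | b in [set b | (b < a)%O]].
Proof.
move=> [a0 aS]; rewrite o1rec_unfold /=; case: (pselect (_ = o1zero)) => // _ /=.
case: (pselect (exists _, _)) => [[b]/aS//|_]; congr l; apply/seteqP; split=> x [b /= ba <-].
  by exists b => //; case: pselect.
by exists b => //; case: pselect.
Qed.

Definition o1one : omega1 := o1succ o1zero.

Definition o1omega : omega1 := o1least [set a | o1limit a].

Definition o1add (a : omega1) : omega1 -> omega1 := o1rec a o1succ o1sup.

Definition o1mul (a : omega1) : omega1 -> omega1 :=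
  o1rec o1zero (fun x => o1add x a) o1sup.

Definition o1exp (a : omega1) : omega1 -> omega1 :=
  o1rec o1one (fun x => o1mul x a) o1sup.

(* Zero and limit ordinals are even, and parity alternates at successors. *)
Definition o1even : omega1 -> bool := o1rec true negb (fun=> true).

(* [None] stands for omega_1. *)
Definition xomega1 : Type := option omega1.

Definition xle (a b : xomega1) : bool :=
  match a, b with
  | _, None => true
  | None, Some _ => false
  | Some a, Some b => (a <= b)%O
  end.

Definition xleast (S : set omega1) : xomega1 :=
  if pselect (S !=set0) then Some (o1least S) else None.

Definition xsup (S : set xomega1) : xomega1 :=
  xleast [set b | forall a, S a -> xle a (Some b)].

Definition ess_le (a b : xomega1) : Prop :=
  forall eta : omega1, (o1one <= eta)%O ->
    xle b (Some (o1exp o1omega eta)) -> xle a (Some (o1exp o1omega eta)).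

Definition ess_eq (a b : xomega1) : Prop := ess_le a b /\ ess_le b a.

Record complete_metric_for (R : realType) (X : topologicalType)
    (d : X -> X -> R) : Prop := CompleteMetricFor {
  cm_ge0 : forall x y, 0 <= d x y ;
  cm_eq0 : forall x y, d x y = 0 <-> x = y ;
  cm_sym : forall x y, d x y = d y x ;
  cm_triangle : forall x y z, d x z <= d x y + d y z ;
  cm_nbhs : forall (x : X) (A : set X),
    nbhs x A <-> exists2 e : R, 0 < e & [set y | d x y < e] `<=` A ;
  cm_complete : forall u : nat -> X,
    (forall e : R, 0 < e -> exists N : nat, forall m n : nat,
       (N <= m)%N -> (N <= n)%N -> d (u m) (u n) < e) ->
    exists x : X, u @ \oo --> x }.

Definition polish (R : realType) (X : topologicalType) : Prop :=
  (exists S : set X, countable S /\ dense S) /\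
  (exists d : X -> X -> R, complete_metric_for d).

Definition baire1 (R : realType) (X : topologicalType) (f : X -> R) : Prop :=
  exists f_ : nat -> X -> R,
    (forall n, continuous (f_ n)) /\ (forall x, f_ ^~ x @ \oo --> f x).

Definition bounded_baire1 (R : realType) (X : topologicalType) (f : X -> R) :
  Prop := bounded_fun f /\ baire1 f.

Definition Delta02 (X : topologicalType) (A : set X) : Prop :=
  Fsigma A /\ Gdelta A.

(* A sequence of length [lambda] is extended by the empty set to all countable
   ordinals. *)
Record continuous_decreasing (X : Type) (lambda : omega1)
    (F : omega1 -> set X) : Prop := ContinuousDecreasing {
  cd_decr : forall a b, (a <= b)%O -> F b `<=` F a ;
  cd_zero : F o1zero = setT ;
  cd_limit : forall a, o1limit a -> (a < lambda)%O ->
    F a = \bigcap_(b in [set b | (b < a)%O]) F b ;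
  cd_end : o1limit lambda -> \bigcap_(b in [set b | (b < lambda)%O]) F b = set0 ;
  cd_above : forall a, (lambda <= a)%O -> F a = set0 }.

Definition transfinite_difference (X : Type) (lambda : omega1)
    (F : omega1 -> set X) : set X :=
  \bigcup_(a in [set a | (a < lambda)%O && o1even a]) (F a `\` F (o1succ a)).

Definition alpha1 (X : topologicalType) (A B : set X) : xomega1 :=
  xleast [set lambda | exists F : omega1 -> set X,
    [/\ continuous_decreasing lambda F,
        forall a, closed (F a),
        A `<=` transfinite_difference lambda F &
        transfinite_difference lambda F `<=` ~` B]].

Definition sep_derivative (X : topologicalType) (A B F : set X) : set X :=
  closure (F `&` A) `&` closure (F `&` B).

Definition sep_iter (X : topologicalType) (A B : set X) (eta : omega1)
    (F : set X) : set X :=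
  o1rec F (sep_derivative A B) (fun S => \bigcap_(G in S) G) eta.

Definition alpha_sets (X : topologicalType) (A B : set X) : xomega1 :=
  xleast [set eta | sep_iter A B eta setT = set0].

Definition alpha (R : realType) (X : topologicalType) (f : X -> R) : xomega1 :=
  xsup [set a | exists p q : rat, p < q /\
    a = alpha_sets [set x | f x <= ratr p] [set x | ratr q <= f x]].

(* Main.v *)
(* Write L for omega^eta; only the fact that L is a limit ordinal matters.

   If alpha(f) <= L, then for p < q the closures of F /\ {f >= q} and of
   F /\ {f <= p}, taken alternately along the ordinals, form a continuous
   decreasing sequence vanishing at stage L. Its transfinite difference is a
   Delta^0_2 set H separating {f <= p} from {f >= q}, and alpha_1(H, X \ H) <= L.
   Since f is a uniform limit of affine images of sums of indicators of such
   sets, rho(f) <= L.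

   Conversely, if D^L_{A,B}(X) contains x for A = {f <= p} and B = {f >= q}, then
   after moving one of the thresholds to f(x) the point x is in A \/ B. A
   transfinite induction yields a closed countable set S included in A \/ B such
   that x remains in D^L_{A,B}(S). On S a piecewise affine h makes h o f the
   indicator of A /\ S, and alpha_1(A /\ S, B /\ S) > L, so that rho(f) > L. *)

Require Import Defs.
From mathcomp Require Import all_boot all_order all_algebra.
From mathcomp Require Import all_classical all_reals all_analysis.
From mathcomp Require Import borel_hierarchy.
From mathcomp Require Import ring lra.
Import Order.TTheory GRing.Theory Num.Theory.
Import numFieldNormedType.Exports.

Set Implicit Arguments.
Unset Strict Implicit.
Unset Printing Implicit Defensive.

Local Open Scope classical_set_scope.
Local Open Scope ring_scope.

(** * Countable ordinals *)

Lemma o1_ind (P : omega1 -> Prop) :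
  P o1zero -> (forall a, P a -> P (o1succ a)) ->
  (forall a, o1limit a -> (forall b, (b < a)%O -> P b) -> P a) ->
  forall a, P a.
Proof.
move=> P0 PS PL; apply: (well_founded_ind o1_wf) => a IH.
have [->//|a0] := pselect (a = o1zero).
have [[b ab]|aS] := pselect (exists b, a = o1succ b).
  by rewrite ab; apply/PS/IH; rewrite ab; exact: lt_o1succ.
by apply: PL => //; split=> // b ab; apply: aS; exists b.
Qed.

Lemma o1limit_gt0 a : o1limit a -> (o1zero < a)%O.
Proof. by move=> [/eqP a0 _]; rewrite lt_neqAle eq_sym a0 o1zero_le. Qed.

Lemma o1limitS a b : o1limit a -> (b < a)%O -> (o1succ b < a)%O.
Proof.
move=> [_ aS] ba; rewrite lt_neqAle o1succ_le// andbT.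
by apply/eqP => /esym/aS.
Qed.

Lemma o1limitI a : (o1zero < a)%O ->
  (forall b, (b < a)%O -> (o1succ b < a)%O) -> o1limit a.
Proof.
move=> a0 aS; split=> [ae|b ab]; first by rewrite ae ltxx in a0.
by have := aS b; rewrite ab lt_o1succ ltxx => /(_ isT).
Qed.

(** If [S] were unbounded, [omega1] would be a countable union of the countable segments below the
    elements of [S]. *)
Lemma o1_countable_bound (S : set omega1) : countable S ->
  exists b, forall a, S a -> (a <= b)%O.
Proof.
move=> cS; apply: contrapT => /forallNP nb; apply: o1_uncountable.
apply: (@sub_countable _ _ _ (\bigcup_(a in S) [set b | (b < a)%O])).
  apply: subset_card_le => b _; have /existsNP[a /not_implyP[Sa ab]] := nb b.
  by exists a => //=; rewrite ltNge; apply/negP.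
by apply: bigcup_countable => // a _; exact: o1_countable_seg.
Qed.

Lemma o1sup_ub (S : set omega1) a : countable S -> S a -> (a <= o1sup S)%O.
Proof. by move=> /o1_countable_bound/o1leastP[ub _] Sa; exact: ub. Qed.

Lemma o1sup_le (S : set omega1) b :
  (forall a, S a -> (a <= b)%O) -> (o1sup S <= b)%O.
Proof.
by move=> Sb; apply: (o1leastP _).2 => //; exists b.
Qed.

Lemma lt_o1sup (S : set omega1) b : (b < o1sup S)%O ->
  exists2 a, S a & (b < a)%O.
Proof.
move=> bS; apply: contrapT => nS; move: bS; rewrite ltNge => /negP; apply.
by apply: o1sup_le => a Sa; rewrite leNgt; apply/negP => ba; apply: nS; exists a.
Qed.

Lemma countable_image_seg (T : Type) (f : omega1 -> T) a :
  countable [set f b | b in [set b | (b < a)%O]].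
Proof. exact: sub_countable (card_image_le _ _) (o1_countable_seg a). Qed.

(** [o1least] is meaningful only on nonempty sets, so some limit must first be produced: the
    supremum of the finite ordinals. *)
Lemma o1omega_limit : o1limit o1omega.
Proof.
suff [a la] : exists a, o1limit a by exact: (o1leastP (ex_intro _ a la)).1.
pose fin := range (fun n => iter n o1succ o1zero).
have cfin : countable fin.
  exact: sub_countable (card_image_le _ _) (countableP _).
have lt_fin n : (iter n o1succ o1zero < o1sup fin)%O.
  apply: lt_le_trans (lt_o1succ _) _; apply: o1sup_ub => //.
  by exists n.+1.
exists (o1sup fin); apply: o1limitI (lt_fin 0%N) _.
move=> b /lt_o1sup[_ [n _ <-] bn].
exact: le_lt_trans (o1succ_le bn) (lt_fin n).
Qed.

Lemma lt_o1add a x : (o1zero < x)%O -> (a < o1add a x)%O.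
Proof.
elim/o1_ind: x => [|x IH _|x lx IH x0]; first by rewrite ltxx.
  rewrite /o1add o1recS; apply: le_lt_trans (lt_o1succ _).
  have [->|x0] := eqVneq x o1zero; first by rewrite o1rec0.
  by apply/ltW/IH; rewrite lt_neqAle eq_sym x0 o1zero_le.
rewrite /o1add o1recL//; have lx1 := o1limitS lx x0.
apply: lt_le_trans (IH _ lx1 (lt_o1succ _)) _.
by apply: o1sup_ub; [exact: countable_image_seg | exists (o1succ o1zero)].
Qed.

(** Adding the nonzero [x] once more is a strict increase, so no [o1mul x b] with [b] finite reaches
    the supremum. *)
Lemma o1mul_omega_limit x : (o1zero < x)%O -> o1limit (o1mul x o1omega).
Proof.
move=> x0; have lw := o1omega_limit.
have mulS b : (b < o1omega)%O -> (o1mul x b < o1mul x o1omega)%O.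
  move=> bw; apply: lt_le_trans (lt_o1add (o1mul x b) x0) _.
  rewrite {2}/o1mul o1recL//.
  apply: o1sup_ub; first exact: countable_image_seg.
  by exists (o1succ b); [exact: o1limitS | rewrite o1recS].
apply: o1limitI => [|b].
  by have := mulS _ (o1limit_gt0 lw); rewrite {1}/o1mul o1rec0.
rewrite {1}/o1mul o1recL// => /lt_o1sup[_ [c cw <-] bc].
by apply: le_lt_trans (o1succ_le bc) _; exact: mulS.
Qed.

Lemma o1exp_gt0 a : (o1zero < o1exp o1omega a)%O.
Proof.
elim/o1_ind: a => [|a IH|a la IH]; rewrite /o1exp.
- by rewrite o1rec0; exact: lt_o1succ.
- by rewrite o1recS; exact/o1limit_gt0/o1mul_omega_limit.
rewrite o1recL//; apply: lt_le_trans (IH _ (o1limit_gt0 la)) _.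
apply: o1sup_ub; first exact: countable_image_seg.
by exists o1zero => //; exact: o1limit_gt0.
Qed.

(** A successor exponent multiplies a positive ordinal by omega. At a limit exponent, an ordinal
    below the supremum is below an earlier power, which is itself a limit unless its exponent is
    zero. *)
Lemma o1exp_limit a : (o1one <= a)%O -> o1limit (o1exp o1omega a).
Proof.
elim/o1_ind: a => [|a _ _|a la IH _].
- by rewrite leNgt lt_o1succ.
- by rewrite /o1exp o1recS; exact/o1mul_omega_limit/o1exp_gt0.
have a1 : (o1one < a)%O by exact/o1limitS/o1limit_gt0.
have ltexp b : (b < a)%O -> (o1exp o1omega b <= o1exp o1omega a)%O.
  move=> ba; rewrite {2}/o1exp o1recL//.
  by apply: o1sup_ub; [exact: countable_image_seg | exists b].
apply: o1limitI (o1exp_gt0 a) _ => b.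
rewrite {1}/o1exp o1recL// => /lt_o1sup[_ [c ca <-] bc].
have [c1|c1] := leP o1one c.
  exact: lt_le_trans (o1limitS (IH _ ca c1) bc) (ltexp _ ca).
(* Exponent zero gives the power 1, so the successor of [b] is at most 1, which is below the limit
   ordinal omega^1. *)
have c0 : c = o1zero.
  apply/eqP; rewrite eq_le o1zero_le andbT leNgt; apply/negP => /o1succ_le.
  by rewrite leNgt c1.
rewrite c0 o1rec0 in bc.
apply: lt_le_trans (ltexp _ a1).
have l1 := IH _ a1 (lexx _).
exact: le_lt_trans (o1succ_le bc) (o1limitS l1 (o1limit_gt0 l1)).
Qed.

Lemma xle_xsup (S : set xomega1) L :
  xle (xsup S) (Some L) <-> (forall a, S a -> xle a (Some L)).
Proof.
rewrite /xsup /xleast; split=> [|SL]; last first.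
  by case: pselect => [ne|[]]; [exact: (o1leastP ne).2 | exists L].
case: pselect => //= ne leL a Sa.
have := (o1leastP ne).1 a Sa; case: a Sa => //= a _ h; exact: le_trans h leL.
Qed.

Lemma xle_xleast (S : set omega1) L :
  xle (xleast S) (Some L) <-> exists2 a, S a & (a <= L)%O.
Proof.
rewrite /xleast; split=> [|[a Sa aL]].
  by case: pselect => //= ne leL; exists (o1least S) => //; exact: (o1leastP ne).1.
case: pselect => [ne|[]]; last by exists a.
by apply: le_trans aL; exact: (o1leastP ne).2.
Qed.

(** * The separation derivative and transfinite differences *)

Lemma o1_decreasing (T : Type) (F : omega1 -> set T) :
  (forall a, F (o1succ a) `<=` F a) ->
  (forall a, o1limit a -> F a `<=` \bigcap_(b in [set b | (b < a)%O]) F b) ->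
  forall a b, (a <= b)%O -> F b `<=` F a.
Proof.
move=> FS FL a; elim/o1_ind => [|b IH|b lb IH]; rewrite le_eqVlt.
- by move=> /predU1P[->//|]; rewrite ltNge o1zero_le.
- move=> /predU1P[->//|]; case: (leP a b) => [ab _|/o1succ_le]; last first.
    by rewrite leNgt => /negbTE->.
  by apply: subset_trans (IH ab); exact: FS.
by move=> /predU1P[->//|ab] x /(FL _ lb); exact.
Qed.

Lemma sep_iterS (X : topologicalType) (A B F : set X) a :
  sep_iter A B (o1succ a) F = sep_derivative A B (sep_iter A B a F).
Proof. exact: o1recS. Qed.

Lemma sep_iterL (X : topologicalType) (A B F : set X) a : o1limit a ->
  sep_iter A B a F = \bigcap_(b in [set b | (b < a)%O]) sep_iter A B b F.
Proof. by move=> la; rewrite /sep_iter o1recL// bigcap_image. Qed.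

Lemma sep_derivative_sub (X : topologicalType) (A A' B B' F F' : set X) :
  A `<=` A' -> B `<=` B' -> F `<=` F' ->
  sep_derivative A B F `<=` sep_derivative A' B' F'.
Proof.
by move=> AA BB FF; apply: setISS; apply: closureS; apply: setISS.
Qed.

Lemma sep_iter_subset (X : topologicalType) (A A' B B' F F' : set X) a :
  A `<=` A' -> B `<=` B' -> F `<=` F' ->
  sep_iter A B a F `<=` sep_iter A' B' a F'.
Proof.
move=> AA BB FF; elim/o1_ind: a => [|a IH|a la IH].
- by rewrite /sep_iter !o1rec0.
- by rewrite !sep_iterS; exact: sep_derivative_sub.
by rewrite !sep_iterL// => x Dx b ba; apply: IH => //; exact: Dx.
Qed.

Lemma sep_iter_closed (X : topologicalType) (A B F : set X) a :
  closed F -> closed (sep_iter A B a F).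
Proof.
move=> cF; elim/o1_ind: a => [|a IH|a la IH].
- by rewrite /sep_iter o1rec0.
- by rewrite sep_iterS; apply: closedI; exact: closed_closure.
- by rewrite sep_iterL//; apply: closed_bigI.
Qed.

Lemma sep_iter_decreasing (X : topologicalType) (A B F : set X) a b :
  closed F -> (a <= b)%O -> sep_iter A B b F `<=` sep_iter A B a F.
Proof.
move=> cF; move: a b; apply: o1_decreasing => [a|a la]; last by rewrite sep_iterL.
rewrite sep_iterS => x [xA _];
  have /closure_id -> := @sep_iter_closed _ A B _ a cF.
by move: x xA; apply: closureS; exact: subIsetl.
Qed.

(** The derivative lies in the closures of both traces, so it is enough that one of the two traces
    on [G b] stays in the closed set [G (o1succ b)]; which one may depend on [b]. *)
Lemma sep_iter_sub (X : topologicalType) (A B F : set X)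
    (G : omega1 -> set X) a :
  (forall b, closed (G b)) -> F `<=` G o1zero ->
  (forall b, G b `&` A `<=` G (o1succ b) \/ G b `&` B `<=` G (o1succ b)) ->
  (forall b, o1limit b -> \bigcap_(c in [set c | (c < b)%O]) G c `<=` G b) ->
  sep_iter A B a F `<=` G a.
Proof.
move=> cG FG GS GL; elim/o1_ind: a => [|a IH|a la IH].
- by rewrite /sep_iter o1rec0.
- rewrite sep_iterS => x [xA xB]; have /closure_id -> := cG (o1succ a).
  by case: (GS a) => GSa; [move: xA | move: xB]; apply: closureS;
    apply: subset_trans GSa; exact: setSI.
- by rewrite sep_iterL// => x Dx; apply: GL => // b ba; apply: IH => //; exact: Dx.
Qed.

(** * Parity, alternating sequences and jumps *)

Lemma o1even0 : o1even o1zero = true.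
Proof. exact: o1rec0. Qed.

Lemma o1evenS a : o1even (o1succ a) = ~~ o1even a.
Proof. exact: o1recS. Qed.

Lemma o1evenL a : o1limit a -> o1even a = true.
Proof. exact: o1recL. Qed.

Lemma alternating_sequence (X : topologicalType) (A B : set X) :
  exists E : omega1 -> set X, [/\ E o1zero = setT,
    forall a, E (o1succ a) = closure (E a `&` if o1even a then B else A) &
    forall a, o1limit a -> E a = \bigcap_(b in [set b | (b < a)%O]) E b].
Proof.
(* The step function of [o1rec] does not see the stage, so the parity is carried along as a second
   component. *)
pose e := o1rec (@setT X, true)
  (fun s => (closure (s.1 `&` if s.2 then B else A), ~~ s.2))
  (fun S => (\bigcap_(s in S) s.1, true)).
have e2 a : (e a).2 = o1even a.
  elim/o1_ind: a => [|a IH|a la _]; rewrite /e.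
  - by rewrite o1rec0 o1even0.
  - by rewrite o1recS o1evenS -IH.
  - by rewrite o1recL// o1evenL.
exists (fst \o e); split=> [|a|a la] /=; rewrite /e.
- by rewrite o1rec0.
- by rewrite o1recS/= -/e e2.
- by rewrite o1recL//= bigcap_image.
Qed.

(** The first stage that misses [x] is neither zero nor, by continuity, a limit, so it is the
    successor of the stage sought; [cd_end] excludes a limit stage equal to [lambda]. *)
Lemma continuous_decreasing_jump (T : Type) lambda (F : omega1 -> set T) x :
  continuous_decreasing lambda F ->
  exists2 a, (a < lambda)%O & (F a `\` F (o1succ a)) x.
Proof.
move=> [Fdecr F0 FL Fend Fge].
have [|b nFb minb] := @o1_min [set a | ~ F a x].
  by exists lambda; rewrite /= Fge.
have Fltb c : (c < b)%O -> F c x.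
  by move=> cb; apply: contrapT => /minb; rewrite leNgt cb.
have ble : (b <= lambda)%O by apply: minb; rewrite /= Fge.
have [b0|b0] := pselect (b = o1zero); first by case: nFb; rewrite b0 F0.
have [[a ba]|bS] := pselect (exists a, b = o1succ a).
  exists a; first by apply: lt_le_trans ble; rewrite ba lt_o1succ.
  by split; [apply: Fltb; rewrite ba lt_o1succ | rewrite -ba].
have lb : o1limit b by split=> // a ba; apply: bS; exists a.
have : (\bigcap_(c in [set c | (c < b)%O]) F c) x by move=> c; exact: Fltb.
move: ble; rewrite le_eqVlt => /predU1P[bl|bl]; last by rewrite -FL.
by move: lb; rewrite bl => /Fend ->.
Qed.

Lemma jump_uniq (T : Type) lambda (F : omega1 -> set T) a b x :
  continuous_decreasing lambda F ->
  (F a `\` F (o1succ a)) x -> (F b `\` F (o1succ b)) x -> a = b.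
Proof.
move=> [Fdecr _ _ _ _] [Fa nFa] [Fb nFb].
case: (ltgtP a b) => // [/o1succ_le|/o1succ_le] /Fdecr Fle.
  by case: nFa; exact: Fle.
by case: nFb; exact: Fle.
Qed.

(** Existence and uniqueness of jumps say that the successive differences partition the space. The
    complement thus has the same shape over odd stages, which is why a transfinite difference of
    closed sets is [Delta02] and not merely [Fsigma]. *)
Lemma setC_transfinite_difference (T : Type) lambda (F : omega1 -> set T) :
  continuous_decreasing lambda F ->
  ~` transfinite_difference lambda F =
  \bigcup_(a in [set a | (a < lambda)%O && ~~ o1even a]) (F a `\` F (o1succ a)).
Proof.
move=> cdF; apply/seteqP; split=> x.
  have [a al Fa] := continuous_decreasing_jump x cdF.
  move=> nx; exists a => //=; rewrite al/=; apply/negP => ea.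
  by apply: nx; exists a => //=; rewrite al.
move=> [a /andP[_ oa] Fa] [b /andP[_ eb] Fb].
by rewrite (jump_uniq cdF Fa Fb) eb in oa.
Qed.

(* Two steps of the alternating sequence are below one step of the derivative,
   so both sequences vanish by the same limit stage. *)
Lemma transfinite_difference_separation (X : topologicalType) (A B : set X) L :
  o1limit L -> sep_iter A B L setT = set0 ->
  exists F : omega1 -> set X,
    [/\ continuous_decreasing L F, forall a, closed (F a),
        A `<=` transfinite_difference L F &
        transfinite_difference L F `<=` ~` B].
Proof.
move=> lL DL0; have [E [E0 ES EL]] := alternating_sequence A B.
have cE a : closed (E a).
  elim/o1_ind: a => [|a _|a la IH]; first by rewrite E0; exact: closedT.
    by rewrite ES; exact: closed_closure.
  by rewrite EL//; apply: closed_bigI.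
have ES_sub a : E (o1succ a) `<=` E a.
  rewrite ES => x; have /closure_id {2}-> := cE a.
  by apply: closureS; exact: subIsetl.
(* Whatever the parity of [a], one of the two steps closes up a trace on [A] and the other a trace
   on [B], both of subsets of [E a]. *)
have ESS a : E (o1succ (o1succ a)) `<=` sep_derivative A B (E a).
  rewrite ES o1evenS => x; case ea: (o1even a) => /= Ex; split.
  - by move: x Ex; apply: closureS; apply: setSI; exact: ES_sub.
  - suff : E (o1succ a) x by rewrite ES ea.
    have /closure_id -> := cE (o1succ a).
    by move: x Ex; apply: closureS; exact: subIsetl.
  - suff : E (o1succ a) x by rewrite ES ea.
    have /closure_id -> := cE (o1succ a).
    by move: x Ex; apply: closureS; exact: subIsetl.
  - by move: x Ex; apply: closureS; apply: setSI; exact: ES_sub.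
(* All limits [M] are considered at once, so that at a limit stage [c] the induction hypothesis can
   be used with [M] equal to [c]. *)
have ED c : forall M, o1limit M -> (c < M)%O ->
    exists2 b, (b < M)%O & E b `<=` sep_iter A B c setT.
  elim/o1_ind: c => [|c IH|c lc IH] M lM cM.
  - by exists o1zero => //; rewrite /sep_iter o1rec0.
  - have [|b bM Eb] := IH M lM; first exact: lt_trans (lt_o1succ _) cM.
    exists (o1succ (o1succ b)); first by do 2 apply: o1limitS => //.
    rewrite sep_iterS; apply: subset_trans (@ESS b) _.
    exact: sep_derivative_sub.
  - exists c => //; rewrite sep_iterL// => x Ex b bc.
    have [d dc] := IH b bc c lc bc; apply; move: Ex; rewrite EL//; exact.
have Edecr : forall a b, (a <= b)%O -> E b `<=` E a.
  by apply: o1_decreasing => // a la; rewrite EL.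
have ELL : \bigcap_(b in [set b | (b < L)%O]) E b = set0.
  apply/seteqP; split=> // x Ex; rewrite -DL0 sep_iterL// => c cL.
  by have [b bL] := ED c L lL cL; apply; exact: Ex.
(* [E] is cut off at [L], as [cd_above] demands; by [ELL] this does not break continuity. *)
pose F a := [set x | (a < L)%O /\ E a x].
have FE a : (a < L)%O -> F a = E a.
  by move=> aL; apply/seteqP; split=> x => [[]|].
have cF a : closed (F a).
  have [aL|La] := ltP a L; first by rewrite FE.
  suff -> : F a = set0 by exact: closed0.
  by apply/seteqP; split=> // x []; rewrite ltNge La.
have cdF : continuous_decreasing L F.
  split.
  - by move=> a b ab x [bL Ex]; split; [exact: le_lt_trans bL|exact: Edecr Ex].
  - by rewrite FE//; exact: o1limit_gt0.
  - move=> a la aL; rewrite FE// EL//; apply: eq_bigcapr => b /= ba.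
    by rewrite FE//; exact: lt_trans aL.
  - by move=> _; rewrite -[RHS]ELL; apply: eq_bigcapr => b /= ba; rewrite FE.
  - by move=> a La; apply/seteqP; split=> // x []; rewrite ltNge La.
exists F; split=> //.
(* After an odd stage comes the closure of the trace on [A], so a point of [A] cannot drop out
   there; dually for [B] at even stages. *)
- move=> x Ax; have [a aL [Fa nFa]] := continuous_decreasing_jump x cdF.
  exists a => //=; rewrite aL/=; apply/negPn/negP => oa; apply: nFa.
  rewrite FE ?ES ?(negbTE oa); last exact: o1limitS.
  by apply: subset_closure; split=> //; case: Fa.
- move=> x [a /andP[aL ea] [[_ Ea] nF]] Bx; apply: nF.
  by rewrite FE ?ES ?ea; [apply: subset_closure|exact: o1limitS].
Qed.

(** * Baire class 1 indicators on metric spaces *)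

Lemma trunc_inv_lt (R : realType) (e : R) :
  0 < e -> (Num.truncn e^-1).+1%:R^-1 < e.
Proof.
move=> e0; rewrite -[ltRHS]invrK ltf_pV2 ?posrE ?invr_gt0 ?ltr0n//.
exact: truncnS_gt.
Qed.

(** The distance to [F] truncated at 1; the extra element keeps the infimum meaningful for empty
    [F]. *)
Definition cap_dist (R : realType) (X : Type) (d : X -> X -> R) (F : set X)
  (x : X) : R := inf ([set 1] `|` [set d x y | y in F]).

Lemma cap_dist_lbound (R : realType) (X : topologicalType) (d : X -> X -> R)
    (F : set X) x : complete_metric_for d ->
  lbound ([set 1] `|` [set d x y | y in F]) (0 : R).
Proof.
by move=> md _ [->//|[y _ <-]]; exact: cm_ge0.
Qed.

Lemma cap_dist_ge0 (R : realType) (X : topologicalType) (d : X -> X -> R)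
    (F : set X) x : complete_metric_for d -> 0 <= cap_dist d F x.
Proof.
by move=> md; apply: lb_le_inf; [exists 1; left | exact: cap_dist_lbound].
Qed.

Lemma cap_dist_in (R : realType) (X : topologicalType) (d : X -> X -> R)
    (F : set X) x : complete_metric_for d -> F x -> cap_dist d F x = 0.
Proof.
move=> md Fx; apply/eqP; rewrite eq_le cap_dist_ge0// andbT.
apply: ge_inf; first by exists 0; exact: cap_dist_lbound.
by right; exists x => //; exact/(cm_eq0 md).
Qed.

Lemma cap_dist_gt0 (R : realType) (X : topologicalType) (d : X -> X -> R)
    (F : set X) x : complete_metric_for d -> closed F -> ~ F x ->
  0 < cap_dist d F x.
Proof.
move=> md cF nFx.
have /(cm_nbhs md)[e e0 eF] : nbhs x (~` F).
  by apply: open_nbhs_nbhs; split=> //; exact: closed_openC.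
apply: (@lt_le_trans _ _ (Num.min 1 e)); first by rewrite lt_min ltr01.
apply: lb_le_inf; first by exists 1; left.
move=> _ [->|[y Fy <-]]; rewrite ge_min ?lexx//.
by apply/orP; right; rewrite leNgt; apply/negP => xy; exact: (eF y xy Fy).
Qed.

Lemma cap_dist_lip (R : realType) (X : topologicalType) (d : X -> X -> R)
    (F : set X) x y : complete_metric_for d ->
  cap_dist d F x <= cap_dist d F y + d x y.
Proof.
move=> md; have lb z := @cap_dist_lbound _ _ _ F z md.
rewrite -lerBlDr; apply: lb_le_inf; first by exists 1; left.
move=> _ [->|[z Fz <-]]; rewrite lerBlDr.
  apply: (@le_trans _ _ 1); last by rewrite lerDl; exact: cm_ge0.
  by apply: ge_inf; [exists 0 | left].
apply: (@le_trans _ _ (d x z)); last by rewrite addrC; exact: cm_triangle.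
by apply: ge_inf; [exists 0 | right; exists z].
Qed.

Lemma cap_dist_continuous (R : realType) (X : topologicalType)
    (d : X -> X -> R) (F : set X) : complete_metric_for d ->
  continuous (cap_dist d F).
Proof.
move=> md x; apply/cvgrPdist_lt => e e0; apply/(cm_nbhs md); exists e => // y xy.
have h1 := @cap_dist_lip _ _ _ F x y md; have h2 := @cap_dist_lip _ _ _ F y x md.
rewrite (cm_sym md y x) in h2; rewrite /= ltr_norml in xy *.
by apply/andP; split; lra.
Qed.

Lemma Fsigma_bigcup (X : topologicalType) (I : choiceType) (D : set I)
    (G : I -> set X) : countable D -> (forall i, D i -> Fsigma (G i)) ->
  Fsigma (\bigcup_(i in D) G i).
Proof.
move=> /countable_injP[g gI] FG.
have /choice[C CP] i : exists C : nat -> set X, D i ->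
    (forall n, closed (C n)) /\ G i = \bigcup_n C n.
  have [/FG[C cC GC]|nDi] := pselect (D i); first by exists C.
  by exists (fun=> set0).
pose K m n := if pselect (exists2 i, D i & g i = m) is left h
  then C (projT1 (cid2 h)) n else set0.
have KE i n : D i -> K (g i) n = C i n.
  move=> Di; rewrite /K; case: pselect => [h|[]]; last by exists i.
  by case: (cid2 h) => j Dj /= /gI; rewrite !inE => /(_ Dj Di) ->.
have cK m n : closed (K m n).
  rewrite /K; case: pselect => [h|_]; last exact: closed0.
  by case: (cid2 h) => j Dj /= _; apply: (CP j Dj).1.
exists (fun k => if @unpickle (nat * nat)%type k is Some (m, n) then K m n
                 else set0).
  by move=> k; case: unpickle => [[m n]|]; [exact: cK | exact: closed0].
apply/seteqP; split=> x [i].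
  move=> Di; have [_ ->] := CP i Di => -[n _ Cx].
  by exists (pickle (g i, n)) => //; rewrite pickleK KE.
move=> _; case: unpickle => [[m n]|//]; rewrite /K.
case: pselect => [h|//]; case: (cid2 h) => j Dj /= _ Cx.
by exists j => //; rewrite (CP j Dj).2; exists n.
Qed.

(** A point outside the closed set [G] has positive distance to it, so the points of [F] at distance
    at least 1/(n+1) from [G] exhaust the difference. *)
Lemma closed_setD_Fsigma (R : realType) (X : topologicalType)
    (d : X -> X -> R) (F G : set X) : complete_metric_for d ->
  closed F -> closed G -> Fsigma (F `\` G).
Proof.
move=> md cF cG.
exists (fun n => F `&` [set x | n.+1%:R^-1 <= cap_dist d G x]).
  move=> n; apply: closedI => //.
  have /continuous_closedP := @cap_dist_continuous _ _ _ G md.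
  by move=> /(_ _ (@closed_ge R n.+1%:R^-1)).
apply/seteqP; split=> x.
  move=> [Fx nGx]; have Gx0 := cap_dist_gt0 md cG nGx.
  exists (Num.truncn (cap_dist d G x)^-1) => //; split=> //=.
  exact/ltW/trunc_inv_lt.
move=> [n _ [Fx /= nx]]; split=> // Gx; move: nx.
by rewrite (cap_dist_in md Gx) leNgt invr_gt0 ltr0n.
Qed.

Lemma transfinite_difference_Delta02 (R : realType) (X : topologicalType)
    (d : X -> X -> R) lambda (F : omega1 -> set X) : complete_metric_for d ->
  continuous_decreasing lambda F -> (forall a, closed (F a)) ->
  Delta02 (transfinite_difference lambda F).
Proof.
move=> md cdF cF.
have Fs (P : omega1 -> bool) : Fsigma
    (\bigcup_(a in [set a | (a < lambda)%O && P a]) (F a `\` F (o1succ a))).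
  apply: Fsigma_bigcup => [|a _]; last exact: closed_setD_Fsigma md _ _.
  apply: sub_countable (o1_countable_seg lambda).
  by apply: subset_card_le => a /= /andP[].
split; first exact: Fs.
have [C cC CE] := Fs (fun a => ~~ o1even a).
exists (fun n => ~` C n); first by move=> n; exact: closed_openC.
by rewrite -setC_bigcup -CE -setC_transfinite_difference// setCK.
Qed.

Lemma Fsigma_bigcup_nondecreasing (X : topologicalType) (A : set X) : Fsigma A ->
  exists C : nat -> set X, [/\ forall n, closed (C n),
    forall m n, (m <= n)%N -> C m `<=` C n & A = \bigcup_n C n].
Proof.
move=> [C cC ->]; exists (fun n => \big[setU/set0]_(i < n.+1) C i); split.
- by move=> n; apply: closed_bigsetU => i _; exact: cC.
- by move=> m n mn; apply: subset_bigsetU.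
- by rewrite bigcup_bigsetU_bigcup.
Qed.

(* [ex_bound] would require [X] to be inhabited. *)
Lemma bounded_fun_ex (R : realType) (X : Type) (f : X -> R) :
  bounded_fun f <-> exists M, forall x, `|f x| <= M.
Proof.
split=> [/pinfty_ex_gt0[M _ fM]|[M fM]]; first by exists M => x; exact: fM.
exists M; split=> [|N /ltW MN x _]; first exact: num_real.
exact: le_trans (fM x) MN.
Qed.

(** [A] and its complement are increasing unions of closed sets [C n] and [E n]. The Urysohn
    functions that are 1 on [C n] and 0 on [E n] are eventually constant at each point. *)
Lemma Delta02_indic_baire1 (R : realType) (X : topologicalType)
    (d : X -> X -> R) (A : set X) : complete_metric_for d -> Delta02 A ->
  bounded_baire1 (\1_A : X -> R).
Proof.
move=> md [FA [G oG AG]]; split.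
  apply/bounded_fun_ex; exists 1 => x.
  by rewrite indicE; case: (_ \in _); rewrite ?normr1 ?normr0.
have [C [cC Cle CE]] := Fsigma_bigcup_nondecreasing FA.
have : Fsigma (~` A).
  exists (fun n => ~` G n); first by move=> n; exact: open_closedC.
  by rewrite AG setC_bigcap.
move=> /Fsigma_bigcup_nondecreasing[E [cE Ele EE]].
(* [C n] and [E n] are disjoint, so the two distances never vanish together and the quotient below
   is continuous. *)
have sum0 n x : 0 < cap_dist d (C n) x + cap_dist d (E n) x.
  have [Cx|nCx] := pselect (C n x); last first.
    by apply: ltr_pwDl; [exact: cap_dist_gt0|exact: cap_dist_ge0].
  apply: ltr_wpDl; first exact: cap_dist_ge0.
  apply: cap_dist_gt0 => // Ex.
  have : A x by rewrite CE; exists n.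
  by have : (~` A) x by rewrite EE; exists n.
exists (fun n x => cap_dist d (E n) x /
  (cap_dist d (C n) x + cap_dist d (E n) x)).
split=> [n x|x].
  apply: cvgM; first exact: cap_dist_continuous md _.
  apply: cvgV; first by rewrite gt_eqF.
  by apply: cvgD; exact: cap_dist_continuous md _.
apply: cvg_near_cst; rewrite indicE.
have [Ax|nAx] := pselect (A x).
  rewrite mem_set//; move: Ax; rewrite {1}CE => -[m _ Cm].
  exists m => // n /= mn.
  rewrite (cap_dist_in md (Cle _ _ mn _ Cm)) add0r divff//.
  rewrite gt_eqF//; have := sum0 n x.
  by rewrite (cap_dist_in md (Cle _ _ mn _ Cm)) add0r.
rewrite memNset//; have : (~` A) x by [].
rewrite EE => -[m _ Em].
exists m => // n /= mn; rewrite (cap_dist_in md (Ele _ _ mn _ Em)) mul0r//.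
Qed.

(** * Sums and Lipschitz images of bounded Baire class 1 functions *)

Lemma baire1D (R : realType) (X : topologicalType) (f g : X -> R) :
  baire1 f -> baire1 g -> baire1 (fun x => f x + g x).
Proof.
move=> [f_ [cf ff]] [g_ [cg gg]]; exists (fun n x => f_ n x + g_ n x); split.
  by move=> n x; apply: cvgD; [exact: cf|exact: cg].
by move=> x; apply: cvgD; [exact: ff|exact: gg].
Qed.

Lemma bounded_baire1D (R : realType) (X : topologicalType) (f g : X -> R) :
  bounded_baire1 f -> bounded_baire1 g -> bounded_baire1 (fun x => f x + g x).
Proof.
move=> [/bounded_fun_ex[M fM] f1] [/bounded_fun_ex[N gN] g1]; split;
  last exact: baire1D.
apply/bounded_fun_ex; exists (M + N) => x /=.
by rewrite (le_trans (ler_normD _ _))// lerD.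
Qed.

Lemma lipschitzP (R : realType) (h : R -> R) (k : R) :
  (forall s t, `|h s - h t| <= k * `|s - t|) -> lipschitz h.
Proof.
move=> hk; apply: (@klipschitzW _ _ _ k).
  exact: (@globally_properfilter _ _ (0, 0)).
by move=> [s t] _ /=; exact: hk.
Qed.

Lemma lipschitz_ex (R : realType) (h : R -> R) : lipschitz h ->
  exists2 k, 0 < k & forall s t, `|h s - h t| <= k * `|s - t|.
Proof.
by move=> /pinfty_ex_gt0[k k0 hk]; exists k => // s t; exact: (hk (s, t)).
Qed.

Lemma bounded_baire1_comp (R : realType) (X : topologicalType) (f : X -> R)
    (h : R -> R) : bounded_baire1 f -> lipschitz h -> bounded_baire1 (h \o f).
Proof.
move=> [/bounded_fun_ex[M fM] [f_ [cf ff]]] /lipschitz_ex[k k0 hk].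
have hc : continuous h.
  move=> s; apply/cvgrPdist_lt => e e0; near=> t.
  apply: le_lt_trans (hk s t) _; rewrite mulrC -ltr_pdivlMr//.
  by near: t; apply: cvgr_dist_lt => //; rewrite divr_gt0.
split.
  apply/bounded_fun_ex; exists (k * M + `|h 0|) => x /=.
  rewrite -[h (f x)](subrK (h 0)) (le_trans (ler_normD _ _))// lerD2r.
  by rewrite (le_trans (hk _ _))// subr0 ler_pM2l.
exists (fun n => h \o f_ n); split.
  by move=> n x; apply: continuous_comp; [exact: cf|exact: hc].
by move=> x; apply: continuous_cvg; [exact: hc|exact: ff].
Unshelve. all: by end_near. Qed.

(** * Countable witnesses for the rank *)

Lemma sep_iter_sub0 (X : topologicalType) (A B F : set X) a :
  closed F -> sep_iter A B a F `<=` F.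
Proof.
move=> cF; have F0 : sep_iter A B o1zero F = F by rewrite /sep_iter o1rec0.
by rewrite -[X in _ `<=` X]F0; exact/sep_iter_decreasing/o1zero_le.
Qed.

Lemma initial_open_ex (X : topologicalType) (S : set X) (O : set (set_type S)) :
  open O -> exists2 V : set X, open V & O = set_val @^-1` V.
Proof. by move=> [V oV <-]; exists V. Qed.

Lemma set_val_image_closed (X : topologicalType) (S : set X)
    (C : set (set_type S)) : closed S -> closed C -> closed (set_val @` C).
Proof.
move=> cS /closed_openC/initial_open_ex[V oV CV].
suff -> : set_val @` C = S `&` ~` V by apply: closedI => //; exact: open_closedC.
apply/seteqP; split=> [_ [z Cz <-]|x [Sx nVx]].
  split; first exact: set_valP.
  by move=> Vz; have : (~` C) z by rewrite CV.
pose z : set_type S := SigSub (mem_set Sx); exists z => //.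
by apply: contrapT => nCz; apply: nVx; have : (~` C) z by []; rewrite CV.
Qed.

(** Since [S] is closed, closed subsets of the subspace have closed images, so closure points found
    in [X] come from the subspace. Injectivity of [set_val] identifies the preimages obtained for
    [A] and [B], or at different stages. *)
Lemma sep_iter_subspace (X : topologicalType) (S A B : set X) c : closed S ->
  sep_iter A B c S `<=`
  set_val @` sep_iter (set_val @^-1` A) (set_val @^-1` B) c [set: set_type S].
Proof.
move=> cS; elim/o1_ind: c => [|c IH|c lc IH].
- rewrite /sep_iter !o1rec0 => x Sx.
  by exists (SigSub (mem_set Sx)).
- rewrite !sep_iterS.
  set E := sep_iter _ _ c _ in IH; set D := sep_iter _ _ c _ in IH *.
  have cl (K : set X) :
      closure (E `&` K) `<=` set_val @` closure (D `&` set_val @^-1` K).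
    have /closure_id -> := set_val_image_closed cS
      (@closed_closure _ (D `&` set_val @^-1` K)).
    apply: closureS => y [/IH[z Dz <-] Kz].
    by exists z => //; exact: subset_closure.
  move=> x [/cl[y Ay yx] /cl[z Bz zx]]; exists y => //; split=> //.
  by have -> : y = z by apply: val_inj; rewrite [LHS]yx [RHS]zx.
- rewrite !sep_iterL// => x Ex.
  have [z _ zx] := IH _ (o1limit_gt0 lc) _ (Ex _ (o1limit_gt0 lc)).
  exists z => // b bc; have [y Dy yx] := IH b bc _ (Ex b bc).
  by have -> : z = y by apply: val_inj; rewrite [LHS]zx [RHS]yx.
Qed.

(** Any separating sequence dominates the iterated derivatives stage by stage, so these vanish at
    the latest where it ends. *)
Lemma transfinite_difference_sep_iter (X : topologicalType) (A B : set X)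
    lambda (F : omega1 -> set X) :
  continuous_decreasing lambda F -> (forall a, closed (F a)) ->
  A `<=` transfinite_difference lambda F ->
  transfinite_difference lambda F `<=` ~` B ->
  sep_iter A B lambda setT = set0.
Proof.
move=> cdF cF AF FB; have [Fdecr F0 FL Fend Fge] := cdF.
suff : sep_iter A B lambda setT `<=` F lambda.
  by rewrite (Fge _ (lexx _)) => ?; apply/seteqP; split.
apply: sep_iter_sub => // [|b|b lb].
- by rewrite F0.
(* At an even stage a point of [B] cannot leave, or it would be in the transfinite difference; at an
   odd stage a point of [A] cannot leave, since its only jump is at an even one. *)
- case eb: (o1even b); [right|left] => x [Fx Kx]; apply: contrapT => nFx.
    apply: (FB x _ Kx); exists b => //=; rewrite eb andbT ltNge; apply/negP.
    by move=> /Fge Fb; rewrite Fb in Fx.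
  have [a /andP[_ ea] Fa] := AF x Kx.
  by have ab := jump_uniq cdF Fa (conj Fx nFx); rewrite ab eb in ea.
- case: (ltgtP b lambda) => [bl|bl|bl] x Fx.
  + by rewrite FL.
  + by have := Fx _ bl; rewrite Fge.
  + by rewrite Fge ?bl//; rewrite bl in lb Fx; rewrite -(Fend lb).
Qed.

Lemma countable_set_type (T : Type) (S : set T) :
  countable S -> countable [set: set_type S].
Proof.
move=> /countable_injP[g gI]; apply/countable_injP.
exists (g \o set_val) => x y _ _ /gI xy.
by apply/val_inj/xy; rewrite inE; exact: set_valP.
Qed.

Lemma polish_closed_countable (R : realType) (X : topologicalType)
    (d : X -> X -> R) (S : set X) : complete_metric_for d ->
  closed S -> countable S -> polish R (set_type S).
Proof.
move=> md cS kS; split.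
  exists setT; split; first exact: countable_set_type.
  by move=> O O0 _; rewrite setIT.
have nbhsd (x : set_type S) (A : set (set_type S)) : nbhs x A <->
    exists2 e : R, 0 < e & [set y | d (set_val x) (set_val y) < e] `<=` A.
  split=> [|[e e0 eA]].
    rewrite nbhsE => -[B [/initial_open_ex[V oV ->] Vx] BA].
    have /(cm_nbhs md)[e e0 eV] : nbhs (set_val x) V by exact: open_nbhs_nbhs.
    by exists e => // y /eV Vy; exact: BA.
  have : nbhs (set_val x) [set y | d (set_val x) y < e].
    by apply/(cm_nbhs md); exists e.
  by move=> /(@initial_continuous (set_type S) X set_val x); exact: filterS eA.
exists (fun x y => d (set_val x) (set_val y)); split=> //.
- by move=> x y; exact: cm_ge0.
- by move=> x y; rewrite (cm_eq0 md); split=> [/val_inj|->].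
- by move=> x y; exact: cm_sym.
- by move=> x y z; exact: cm_triangle.
move=> u uC; have [x ux] := cm_complete md (u := set_val \o u) uC.
have Sx : S x.
  by apply: closed_cvg cS _ _ ux; apply: nearW => n; exact: set_valP.
exists (SigSub (mem_set Sx)) => A /nbhsd[e e0 eA].
have /ux : nbhs x [set y | d x y < e] by apply/(cm_nbhs md); exists e.
exact: filterS (fun n => eA (u n)).
Qed.

(** * Gluing countable closed sets at a point *)

Lemma nbhs_harmonic_ball (R : realType) (X : topologicalType)
    (d : X -> X -> R) x n : complete_metric_for d ->
  nbhs x [set y | d x y < n.+1%:R^-1].
Proof.
move=> md; apply/(cm_nbhs md); exists n.+1%:R^-1; last exact: subset_refl.
by rewrite invr_gt0 ltr0n.
Qed.

Lemma harmonic_ball_sub (R : realType) (X : topologicalType)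
    (d : X -> X -> R) x (V : set X) : complete_metric_for d -> nbhs x V ->
  exists n, [set y | d x y < n.+1%:R^-1] `<=` V.
Proof.
move=> md /(cm_nbhs md)[e e0 eV]; exists (Num.truncn e^-1) => y /= xy; apply: eV.
exact: lt_trans xy (trunc_inv_lt e0).
Qed.

(* The sets [T n] shrink to [x], so their union with [x] is closed. *)
Lemma shrinking_union (R : realType) (X : topologicalType) (d : X -> X -> R)
    (x : X) (V : set X) (Q : nat -> set X -> Prop) : complete_metric_for d ->
  V x ->
  (forall n, exists T, [/\ closed T, countable T,
    T `<=` V `&` [set y | d x y < n.+1%:R^-1] & Q n T]) ->
  exists S, [/\ closed S, countable S, S `<=` V, S x & forall n, exists T,
    [/\ closed T, T `<=` S, T `<=` [set y | d x y < n.+1%:R^-1] & Q n T]].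
Proof.
move=> md Vx /choice[T TP].
exists (\bigcup_n T n `|` [set x]); split.
- move=> y; apply: contraPP => nSy Sy.
  have xy0 : 0 < d x y.
    rewrite lt_neqAle cm_ge0// andbT; apply/eqP => /esym/(cm_eq0 md) xy.
    by apply: nSy; right.
  (* From index [N] on, the sets lie within d(x,y)/2 of [x], hence farther than d(x,y)/2 from [y];
     the finitely many earlier ones form the closed set [K]. *)
  set N := Num.truncn (d x y / 2)^-1.
  have Nxy : N.+1%:R^-1 < d x y / 2 by apply: trunc_inv_lt; exact: divr_gt0.
  set K := \big[setU/set0]_(i < N) T i.
  have cK : closed K by apply: closed_bigsetU => i _; have [] := TP i.
  have nKy : (~` K) y.
    move=> Ky; apply: nSy; left; move: Ky; rewrite /K -bigcup_mkord.
    by move=> [i iN Ti]; exists i.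
  have /Sy[z []] : nbhs y (~` K `&` [set z | d y z < d x y / 2]).
    apply: filterI; first by apply: open_nbhs_nbhs; split=> //; exact: closed_openC.
    by apply/(cm_nbhs md); exists (d x y / 2) => //; exact: divr_gt0.
  move=> [[n _ Tz]|->] [nKz /= yz]; last by rewrite (cm_sym md y x) in yz; lra.
  have [nN|Nn] := ltnP n N.
    by apply: nKz; rewrite /K -bigcup_mkord; exists n.
  have [_ _ /(_ z Tz)[_ /= xz] _] := TP n.
  have := cm_triangle md x z y; rewrite (cm_sym md z y).
  have : n.+1%:R^-1 <= N.+1%:R^-1 :> R.
    by rewrite lef_pV2 ?posrE ?ltr0n// ler_nat.
  move=> /(lt_le_trans xz) /lt_trans/(_ Nxy) xz2 tri.
  lra.
- apply: countable_setU; last exact: countable1.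
  by apply: bigcup_countable => // n _; have [] := TP n.
- by move=> y [[n _ Ty]|->//]; have [_ _ /(_ y Ty)[]] := TP n.
- by right.
- move=> n; exists (T n); have [cT _ TV Qn] := TP n; split=> //.
    by move=> y Ty; left; exists n.
  by apply: subset_trans TV _; exact: subIsetr.
Qed.

(** Induction on [c] for all [x] and [U] together: witnesses of earlier stages are taken inside ever
    smaller balls around [x] and glued by [shrinking_union]. *)
Lemma sep_iter_countable_witness (R : realType) (X : topologicalType)
    (d : X -> X -> R) (A B : set X) c x (U : set X) : complete_metric_for d ->
  (A `|` B) x -> sep_iter A B c setT x -> nbhs x U ->
  exists S, [/\ closed S, countable S, S `<=` (A `|` B) `&` U, S x &
    sep_iter A B c S x].
Proof.
move=> md; elim/o1_ind: c x U => [|c IH|c lc IH] x U ABx Dx nU;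
  have ABUx : ((A `|` B) `&` U) x by (split=> //; exact: nbhs_singleton).
- have [|S [cS kS SV Sx _]] := @shrinking_union _ _ d x _ (fun _ _ => True) md ABUx.
    move=> n; exists set0; split=> //; exact: closed0.
  by exists S; split=> //; rewrite /sep_iter o1rec0.
- rewrite sep_iterS in Dx.
  (* Each ball receives a point of [A] and a point of [B] that survive [c] steps; their accumulation
     at [x] keeps [x] for one step more. *)
  pose Q (n : nat) (T : set X) := sep_iter A B c T `&` A !=set0 /\
                          sep_iter A B c T `&` B !=set0.
  have [|S [cS kS SV Sx SQ]] := @shrinking_union _ _ d x _ Q md ABUx.
    (* Taking the interior makes the region a neighbourhood of the nearby points [a] and [b] as
       well, as the induction hypothesis requires. *)
    move=> n; pose W := (U `&` [set y | d x y < n.+1%:R^-1])°.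
    have Wx : nbhs x W.
      apply: open_nbhs_nbhs; split; first exact: open_interior.
      apply: filterI => //; exact: nbhs_harmonic_ball.
    have WP y : W y -> nbhs y (U `&` [set y | d x y < n.+1%:R^-1]) by [].
    have [a [[Da Aa] /WP Wa]] := Dx.1 _ Wx.
    have [b [[Db Bb] /WP Wb]] := Dx.2 _ Wx.
    have [Sa [cSa kSa SaV Saa DSa]] := IH a _ (or_introl Aa) Da Wa.
    have [Sb [cSb kSb SbV Sbb DSb]] := IH b _ (or_intror Bb) Db Wb.
    exists (Sa `|` Sb); split.
    + exact: closedU.
    + exact: countable_setU.
    + by move=> y [/SaV|/SbV] [? [? ?]].
    + split; [exists a|exists b]; split=> //.
        by apply: (sep_iter_subset _ _ _ DSa) => //; exact: subsetUl.
      by apply: (sep_iter_subset _ _ _ DSb) => //; exact: subsetUr.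
  exists S; split=> //; rewrite sep_iterS.
  split=> V /(harmonic_ball_sub md)[n nV];
    have [T [cT TS Tn [[a [Da Aa]] [b [Db Bb]]]]] := SQ n.
    exists a; split; last exact/nV/Tn/(sep_iter_sub0 cT Da).
    by split=> //; apply: (sep_iter_subset _ _ TS Da).
  exists b; split; last exact/nV/Tn/(sep_iter_sub0 cT Db).
  by split=> //; apply: (sep_iter_subset _ _ TS Db).
- have /countable_injP[g gI] := o1_countable_seg c.
  (* There are countably many stages below [c]; the witness for stage [b] goes into the ball of
     index [g b]. *)
  pose Q (n : nat) (T : set X) :=
    forall b, (b < c)%O -> g b = n -> sep_iter A B b T x.
  have [|S [cS kS SV Sx SQ]] := @shrinking_union _ _ d x _ Q md ABUx.
    move=> n; have [[b bc gb]|nb] :=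
      pselect (exists2 b, (b < c)%O & g b = n); last first.
      exists set0; split=> //; first exact: closed0.
      by move=> b bc gb; case: nb; exists b.
    have [|||T [cT kT TV Tx DT]] :=
      IH b bc x (U `&` [set y | d x y < n.+1%:R^-1]).
    + by [].
    + by move: Dx; rewrite sep_iterL//; exact.
    + apply: filterI => //; exact: nbhs_harmonic_ball.
    exists T; split=> //; first by move=> y /TV[? [? ?]].
    by move=> b' b'c; rewrite -gb => /gI bb; rewrite bb ?inE.
  exists S; split=> //; rewrite sep_iterL// => b bc.
  have [T [_ TS _ QT]] := SQ (g b).
  by move: (QT b bc erefl); apply: sep_iter_subset.
Qed.

(** * Ranks of functions *)

Lemma countable_Fsigma (R : realType) (X : topologicalType) (d : X -> X -> R)
    (A : set X) : complete_metric_for d -> countable A -> Fsigma A.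
Proof.
move=> md cA.
have -> : A = \bigcup_(x in A) [set x].
  by apply/seteqP; split=> [x Ax|x [y Ay ->]//]; exists x.
apply: Fsigma_bigcup => // x _; apply: closed_Fsigma => y yx.
apply: contrapT => nyx; have yx0 : 0 < d y x.
  rewrite lt_neqAle cm_ge0// andbT; apply/eqP => /esym/(cm_eq0 md) yxE.
  exact: nyx.
have [|_ [-> /=]] := yx [set z | d y z < d y x]; last by rewrite ltxx.
by apply/(cm_nbhs md); exists (d y x).
Qed.

Lemma clamp_contraction (R : realType) (u v : R) :
  `|Num.min 1 (Num.max 0 u) - Num.min 1 (Num.max 0 v)| <= `|u - v|.
Proof.
have [? ?] : u - v <= `|u - v| /\ v - u <= `|u - v|.
  by rewrite ler_norm -normrN opprB ler_norm.
by case: (leP 0 u) => ?; case: (leP 0 v) => ?; rewrite ?(min_r ler01);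
  try case: (leP 1 u) => ?; try case: (leP 1 v) => ?;
  rewrite ler_norml; apply/andP; split; lra.
Qed.

(** For [s < r], the affine descent from 1 at [s] to 0 at [r], extended by constants; it turns [f]
    into an indicator wherever [f] avoids the open interval between them. *)
Definition ramp (R : realType) (s r t : R) : R :=
  Num.min 1 (Num.max 0 ((r - t) / (r - s))).

Lemma ramp_lipschitz (R : realType) (s r : R) : s < r -> lipschitz (ramp s r).
Proof.
move=> sr; have rs0 : 0 < r - s by rewrite subr_gt0.
apply: (@lipschitzP _ _ (r - s)^-1) => t t'.
apply: le_trans (clamp_contraction _ _) _.
rewrite -mulrBl normrM [leRHS]mulrC [`|(_ - _)^-1|]gtr0_norm ?invr_gt0//.
by rewrite ler_pM2r ?invr_gt0// opprB addrC addrA subrK distrC.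
Qed.

Lemma ramp1 (R : realType) (s r t : R) : s < r -> t <= s -> ramp s r t = 1.
Proof.
move=> sr ts; have rs0 : 0 < r - s by rewrite subr_gt0.
apply/min_idPl; rewrite le_max ler_pdivlMr// mul1r; apply/orP; right; lra.
Qed.

Lemma ramp0 (R : realType) (s r t : R) : s < r -> r <= t -> ramp s r t = 0.
Proof.
move=> sr rt; have rs0 : 0 < r - s by rewrite subr_gt0.
rewrite /ramp max_l ?min_r ?ler01//.
by rewrite ler_pdivrMr// mul0r subr_le0.
Qed.

(** On a countable witness inside the two level sets the ramp takes only the values 0 and 1, and
    every subset of a countable metric space is [Delta02]. A separating sequence of length at most
    [L] would kill the derivatives of the subspace by stage [L], yet [x] survives there. *)
Lemma indicator_restriction (R : realType) (X : topologicalType)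
    (f : X -> R) (s r : R) L x : polish R X -> s < r ->
  ([set y | f y <= s] `|` [set y | r <= f y]) x ->
  sep_iter [set y | f y <= s] [set y | r <= f y] L setT x ->
  exists (S : set X) (C : set (set_type S)),
    [/\ polish R (set_type S), Delta02 C,
      ramp s r \o f \o set_val = \1_C :> (set_type S -> R) &
      ~~ xle (alpha1 C (~` C)) (Some L)].
Proof.
move=> [_ [d md]] sr ABx Dx.
have [S [cS kS SAB Sx DSx]] := sep_iter_countable_witness md ABx Dx filterT.
have polS := polish_closed_countable md cS kS.
have [_ [dS mdS]] := polS.
have FsS (C : set (set_type S)) : Fsigma C.
  apply: countable_Fsigma mdS _.
  by apply: sub_countable (countable_set_type kS); exact: subset_card_le.
exists S, (set_val @^-1` [set y | f y <= s]); split=> //.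
- split=> //; have [G cG GE] := FsS (~` (set_val @^-1` [set y | f y <= s])).
  exists (fun n => ~` G n); first by move=> n; exact: closed_openC.
  by rewrite -setC_bigcup -GE setCK.
- apply/funext => y; rewrite indicE /=; have [|[ry|ry] _] := SAB (set_val y).
  + exact: set_valP.
  + by rewrite mem_set// ramp1.
  + by rewrite memNset ?ramp0//= => ys; move: (le_trans ry ys); rewrite leNgt sr.
- apply/negP => /xle_xleast[lambda [F [cdF cF AF FB]] lL].
  have D0 := transfinite_difference_sep_iter cdF cF AF FB.
  have [y Dy _] := sep_iter_subspace cS DSx.
  suff : (set0 : set (set_type S)) y by [].
  rewrite -D0; apply: (sep_iter_decreasing closedT lL).
  (* The two level sets are disjoint, so replacing the upper one by the complement of [C] only
     enlarges the derivatives. *)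
  apply: (sep_iter_subset _ _ _ Dy) => // z /= rz zs.
  by move: (le_trans rz zs); rewrite leNgt sr.
Qed.

(** The value [c i] is forced to be 0 or 1 unless i < g < i+1, which happens for at most one [i];
    hence an error of at most 1. The first half of the conclusion feeds the induction. *)
Lemma sum_unit_steps (R : realType) (g : R) (c : nat -> R) :
  0 <= g -> (forall i, 0 <= c i <= 1) -> (forall i, g <= i%:R -> c i = 0) ->
  (forall i, i.+1%:R <= g -> c i = 1) -> forall k,
  (k%:R <= g -> \sum_(i < k) c i = k%:R) /\
  (g <= k%:R -> `|\sum_(i < k) c i - g| <= 1).
Proof.
move=> g0 c01 c0 c1; elim=> [|k [IH1 IH2]].
  rewrite big_ord0; split=> // gle0.
  have -> : g = 0 by apply/eqP; rewrite eq_le g0 gle0.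
  by rewrite subrr normr0 ler01.
have kS : k.+1%:R = k%:R + 1 :> R by rewrite natr1.
rewrite big_ord_recr/=; split=> gk.
  by rewrite IH1 ?c1//; lra.
have [gk'|kg] := leP g k%:R; first by rewrite (c0 k)// addr0 IH2.
rewrite IH1 ?(ltW kg)//; have /andP[ck0 ck1] := c01 k.
by rewrite ler_norml; apply/andP; split; lra.
Qed.

Lemma uniform_cvg_harmonic (R : realType) (X : topologicalType)
    (f_ : nat -> X -> R) (f : X -> R) :
  (forall n x, `|f x - f_ n x| <= n.+1%:R^-1) -> {uniform, f_ @ \oo --> f}.
Proof.
move=> ff P /uniform_nbhs[E [entE EP]].
have [e /= e0 eE] : exists2 e : R, 0 < e &
    [set xy | ball xy.1 e xy.2] `<=` E.
  by move: entE; rewrite -entourage_ballE.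
exists (Num.truncn e^-1) => // n /= ne; apply: EP => x _; apply: eE => /=.
rewrite /ball/= (le_lt_trans (ff n x))// (le_lt_trans _ (trunc_inv_lt e0))//.
by rewrite lef_pV2 ?posrE ?ltr0n// ler_nat.
Qed.

(** With levels 1/(n+1) apart and one separating function per gap, the sum counts the levels below
    [f x] up to an error of 1, which rescaling turns into 1/(n+1). The class [C] will consist of the
    bounded Baire class 1 functions of rank at most [L]. *)
Lemma uniform_step_approximation (R : realType) (X : topologicalType)
    (f : X -> R) L (C : (X -> R) -> Prop) :
  polish R X -> bounded_fun f -> o1limit L ->
  (forall p q : rat, p < q ->
    sep_iter [set x | f x <= ratr p] [set x | ratr q <= f x] L setT = set0) ->
  (forall H, Delta02 H -> xle (alpha1 H (~` H)) (Some L) -> C \1_H) ->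
  (forall g h, C g -> C h -> C (fun x => g x + h x)) ->
  (forall g h, lipschitz h -> C g -> C (h \o g)) ->
  exists2 f_ : nat -> X -> R, forall n, C (f_ n) & {uniform, f_ @ \oo --> f}.
Proof.
move=> [_ [d md]] /bounded_fun_ex[M fM] lL fL C1 CD Clip.
have sepC (p q : rat) : p < q -> exists2 c : X -> R, C c &
    [/\ forall x, 0 <= c x <= 1, forall x, f x <= ratr p -> c x = 0 &
        forall x, ratr q <= f x -> c x = 1].
  move=> pq.
  have [F [cdF cF AF FB]] := transfinite_difference_separation lL (fL p q pq).
  set H := transfinite_difference L F in AF FB.
  (* [H] contains the lower level set, where the separating function has to be 0; hence the
     indicator of the complement. *)
  exists ((fun t => 1 - t) \o \1_H).
    apply: Clip; last apply: C1.
    - apply: (@lipschitzP _ _ 1) => s t.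
      by rewrite mul1r opprB addrC addrA subrK distrC.
    - exact: transfinite_difference_Delta02 md cdF cF.
    - by apply/xle_xleast; exists L => //; exists F; split=> //; rewrite setCK.
  split=> x; rewrite /= indicE.
  - by case: (_ \in _) => /=; rewrite ?subrr ?subr0 lexx ler01.
  - by move=> /AF Hx; rewrite mem_set// subrr.
  - by move=> Bx; rewrite memNset ?subr0// => /FB; exact.
(* The empty sum below must be in [C]; it is the image of any member of [C] under a constant map. *)
have C0 : C (fun=> 0).
  have [c Cc _] := sepC 0 1 ltr01.
  apply: (Clip c (fun=> 0)) => //; apply: (@lipschitzP _ _ 0) => s t.
  by rewrite subrr normr0 mul0r.
pose N := (Num.truncn M).+1.
have fN x : `|f x| < N%:R by apply: le_lt_trans (fM x) _; exact: truncnS_gt.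
have approx n : exists2 g : X -> R, C g & forall x, `|f x - g x| <= n.+1%:R^-1.
  pose m : R := n.+1%:R; have m0 : 0 < m by rewrite ltr0n.
  pose p i : rat := i%:R / n.+1%:R - N%:R.
  have pE i : ratr (p i) = i%:R / m - N%:R :> R.
    by rewrite /p rmorphB/= fmorph_div/= !ratr_nat.
  have /choice[c cP] i : exists c : X -> R, C c /\
      [/\ forall x, 0 <= c x <= 1, forall x, f x <= ratr (p i) -> c x = 0 &
          forall x, ratr (p i.+1) <= f x -> c x = 1].
    have [|c] := sepC (p i) (p i.+1); last by exists c.
    by rewrite ltrD2r ltr_pM2r ?invr_gt0 ?ltr0n// ltr_nat.
  (* This many gaps of length 1/(n+1), starting at -N, reach N and so cover the range of [f]. *)
  pose k := (2 * N * n.+1)%N.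
  exists ((fun t => t / m - N%:R) \o (fun x => \sum_(i < k) c i x)).
    apply: Clip.
      apply: (@lipschitzP _ _ m^-1) => s t.
      rewrite opprB addrA subrK -mulrBl normrM [leRHS]mulrC.
      by rewrite [`|m^-1|]gtr0_norm ?invr_gt0.
    elim: k => [|k IH].
      by under eq_fun do rewrite big_ord0.
    under eq_fun do rewrite big_ord_recr/=.
    by apply: CD => //; have [] := cP k.
  (* Shifting by [N] and multiplying by [m] turns the thresholds [p i] into the integers [i]. *)
  move=> x /=; pose g := (f x + N%:R) * m.
  have := fN x; rewrite ltr_norml => /andP[fN1 fN2].
  have g0 : 0 <= g by rewrite mulr_ge0 ?(ltW m0)//; lra.
  have gE t : (f x <= t / m - N%:R) = (g <= t) by rewrite lerBrDr ler_pdivlMr.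
  have gE' t : (t / m - N%:R <= f x) = (t <= g) by rewrite lerBlDr ler_pdivrMr.
  have [|||_ sk] := @sum_unit_steps _ g (fun i => c i x) g0 _ _ _ k.
  - by move=> i; have [_ []] := cP i.
  - by move=> i gi; have [_ [_ + _]] := cP i; apply; rewrite pE gE.
  - by move=> i gi; have [_ [_ _]] := cP i; apply; rewrite pE gE'.
  have gk : g <= k%:R.
    rewrite /g /k natrM ler_pM2r// natrM; lra.
  have := sk gk; set s := \sum_(i < k) c i x => sg.
  have -> : f x - (s / m - N%:R) = - ((s - g) / m).
    by rewrite /g; field; rewrite gt_eqF.
  rewrite normrN normrM [`|m^-1|]gtr0_norm ?invr_gt0//.
  by rewrite ler_pdivrMr// mulVf ?gt_eqF.
have /choice[f_ fP] n : exists g : X -> R,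
    C g /\ forall x, `|f x - g x| <= n.+1%:R^-1.
  by have [g Cg gf] := approx n; exists g.
exists f_; first by move=> n; have [] := fP n.
by apply: uniform_cvg_harmonic => n x; have [_] := fP n; exact.
Qed.

Theorem theorem6p1 (R : realType)
  (rho : forall X : topologicalType, (X -> R) -> omega1)
  (rho_indic : forall (X : topologicalType) (A : set X),
    polish R X -> Delta02 A ->
    ess_eq (Some (rho X (\1_A : X -> R))) (alpha1 A (~` A)))
  (rho_scale : forall (X : topologicalType) (f : X -> R) (c : R),
    polish R X -> bounded_baire1 f -> c != 0 ->
    ess_eq (Some (rho X (fun x => c * f x))) (Some (rho X f)))
  (rho_add : forall (X : topologicalType) (f g : X -> R),
    polish R X -> bounded_baire1 f -> bounded_baire1 g ->
    ess_le (Some (rho X (fun x => f x + g x)))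
           (Some (Order.max (rho X f) (rho X g))))
  (rho_uniform : forall (X : topologicalType) (f_ : nat -> X -> R) (f : X -> R),
    polish R X -> (forall n, bounded_baire1 (f_ n)) -> bounded_baire1 f ->
    {uniform, f_ @ \oo --> f} ->
    ess_le (Some (rho X f)) (xsup (range (fun n => Some (rho X (f_ n))))))
  (rho_lipschitz : forall (X : topologicalType) (f : X -> R) (h : R -> R),
    polish R X -> bounded_baire1 f -> lipschitz h ->
    ess_le (Some (rho X (h \o f))) (Some (rho X f)))
  (rho_restr : forall (X : topologicalType) (Y : set X) (f : X -> R),
    polish R X -> polish R (set_type Y) -> bounded_baire1 f ->
    ess_le (Some (rho (set_type Y) (f \o set_val))) (Some (rho X f))) :
  forall (X : topologicalType) (f : X -> R),
    polish R X -> bounded_baire1 f -> ess_eq (Some (rho X f)) (alpha f).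
Proof.
move=> X f polX bf; split=> eta eta1 /=.
- move=> /xle_xsup fL; have lL := o1exp_limit eta1.
  set L := o1exp o1omega eta in fL lL *.
  (* [ess_le] transfers exactly the bounds of the form omega^eta, so the assumptions on indicators,
     sums and Lipschitz maps become closure properties of [C]. *)
  pose C (g : X -> R) := bounded_baire1 g /\ (rho X g <= L)%O.
  have [f_ Cf ff] : exists2 f_ : nat -> X -> R,
      forall n, C (f_ n) & {uniform, f_ @ \oo --> f}.
    apply: (uniform_step_approximation polX bf.1 lL).
    (* The derivatives vanish at some stage at most [L], and since they decrease they still vanish
       at [L]. *)
    + move=> p q pq; have := fL _ (ex_intro _ p (ex_intro _ q (conj pq erefl))).
      move=> /xle_xleast[c Dc cL]; apply/seteqP; split=> // x Dx; rewrite -Dc.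
      exact: sep_iter_decreasing closedT cL _ Dx.
    + move=> H DH HL; split; last exact: (rho_indic X H polX DH).1.
      by have [_ [d md]] := polX; exact: Delta02_indic_baire1 md DH.
    + move=> g h [bg gL] [bh hL]; split; first exact: bounded_baire1D.
      by apply: (rho_add X g h) => //=; rewrite ge_max gL.
    + move=> g h lh [bg gL]; split; first exact: bounded_baire1_comp.
      exact: (rho_lipschitz X g h).
  apply: (rho_uniform X f_ f polX _ bf ff) => // [n|]; first exact: (Cf n).1.
  by apply/xle_xsup => _ [n _ <-]; exact: (Cf n).2.
- move=> fL; apply/xle_xsup => _ [p [q [pq ->]]].
  set L := o1exp o1omega eta in fL *.
  apply/xle_xleast; exists L => //; apply/seteqP; split=> // x Dx.
  have [s [r [sr ABx Dsr]]] : exists s r : R, [/\ s < r,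
      ([set y | f y <= s] `|` [set y | r <= f y]) x &
      sep_iter [set y | f y <= s] [set y | r <= f y] L setT x].
    have pqR : ratr p < ratr q :> R by rewrite ltr_rat.
    have [qf|fq] := leP (ratr q) (f x).
      by exists (ratr p), (ratr q); split; [|right|].
    (* Here f(x) is below [q]: raising the lower threshold to at least f(x) keeps it below [q], puts
       [x] into the lower set and only enlarges the derivatives. *)
    exists (Num.max (ratr p) (f x)), (ratr q); split.
    + by rewrite gt_max pqR.
    + by left; rewrite /= le_max lexx orbT.
    + by apply: (sep_iter_subset _ _ _ Dx) => // y /=; rewrite le_max => ->.
  have [S [C [polS DC fC /negP[]]]] := indicator_restriction polX sr ABx Dsr.
  (* The bound [L] passes from [f] to its ramp, then to the restriction to [S], which is the
     indicator of [C], and finally to [alpha1], where it is contradictory. *)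
  apply: (rho_indic _ C polS DC).2 => //; rewrite -fC.
  have brf := bounded_baire1_comp bf (ramp_lipschitz sr).
  apply: (rho_restr X S (ramp s r \o f)) => //.
  exact: (rho_lipschitz X f _ polX bf (ramp_lipschitz sr)).
Qed.
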